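(* Let $\alpha\geq 1$ be a real number and let $x$ be an infinite word over a finite nonempty alphabet with $p_x(n)=O(n^\alpha)$. Then $c(x)\leq \min\{\alpha, 2\alpha - 2\}$.
   Context: For a language $L$ (a set of finite words over a finite alphabet), $p_L(n)$ is the number of words of length $n$ in $L$. For a (one-sided) infinite word $x$, $\mathrm{Fac}(x)$ is the set of all finite blocks of consecutive letters of $x$, including the empty word, and $p_x(n)=p_{\mathrm{Fac}(x)}(n)$. $S^k$ denotes the set of all concatenations of $k$ elements of $S$. For real $\beta\ge 0$, $\mathcal{L}(\beta)$ is the collection of languages $S$ over some finite nonempty alphabet with $p_S(n)=O(n^\beta)$. Define $d_\beta(x)=\inf\{k\ge 1 : \mathrm{Fac}(x)\subseteq S^k \text{ for some } S\in\mathcal{L}(\beta)\}$ and the cost $c(x)=\inf\{\beta\in[0,+\infty) : d_\beta(x)<+\infty\}$, with $\inf\emptyset=+\infty$. *)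

(* Defs.v *)
From HB Require Import structures.
From mathcomp Require Import all_boot all_order all_algebra.
From mathcomp Require Import finmap.
From mathcomp Require Import all_classical all_reals all_analysis.

Set Implicit Arguments.
Unset Strict Implicit.
Unset Printing Implicit Defensive.

Import Order.TTheory GRing.Theory Num.Theory.
Import numFieldNormedType.Exports.

Local Open Scope classical_set_scope.
Local Open Scope ring_scope.

(* Letters live in an arbitrary choiceType T; an alphabet is a nonempty
   A : {fset T}.  In this way the alphabet of a language S covering Fac(x)
   may differ from the alphabet of x. *)

Definition language_over (T : choiceType) (A : {fset T}) (L : set (seq T))
    : Prop :=
  forall w, L w -> forall a, a \in w -> a \in A.

(* fset_set is meaningful only on finite sets; here L is always a language
   over a finite alphabet, so that it has finitely many words of length n. *)
Definition complexity (T : choiceType) (L : set (seq T)) (n : nat) : nat :=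
  #|` fset_set [set w | L w /\ size w = n]|.

Definition Fac (T : choiceType) (x : nat -> T) : set (seq T) :=
  [set w | exists i n, w = [seq x j | j <- iota i n]].

Definition lang_pow (T : choiceType) (S : set (seq T)) (k : nat)
    : set (seq T) :=
  [set w | exists ws : seq (seq T),
    [/\ size ws = k, forall u, u \in ws -> S u & w = flatten ws]].

Definition poly_growth (R : realType) (T : choiceType) (L : set (seq T))
    (beta : R) : Prop :=
  (fun n : nat => (complexity L n)%:R : R^o)
    =O_\oo (fun n : nat => n%:R `^ beta : R^o).

Definition lang_class (R : realType) (T : choiceType) (beta : R)
    : set (set (seq T)) :=
  [set S | exists A : {fset T},
    [/\ A != fset0, language_over A S & poly_growth S beta]].

Definition cost_dim (R : realType) (T : choiceType) (beta : R) (x : nat -> T)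
    : \bar R :=
  ereal_inf [set (k%:R)%:E | k in [set k : nat | (1 <= k)%N /\
    exists S, lang_class beta S /\ Fac x `<=` lang_pow S k]].

Definition cost (R : realType) (T : choiceType) (x : nat -> T) : \bar R :=
  ereal_inf [set beta%:E | beta in
    [set beta : R | 0 <= beta /\ (cost_dim beta x < +oo)%E]].

(* Main.v *)
Require Import Defs.
From HB Require Import structures.
From mathcomp Require Import all_boot all_order all_algebra.
From mathcomp Require Import finmap.
From mathcomp Require Import all_classical all_reals all_analysis.
From mathcomp Require Import zify lra.

(** The cost of [x] is in fact at most [alpha - 1], which lies below both
[alpha] and [2 * alpha - 2]; two factors suffice. Write [p] for the
complexity of [x].

Fix a scale [a]. Since [p] can only increase by [p a.*2] in total between [a]
and [a.*2], some [m] there satisfies [p m.+1 - p m <= p a.*2 / a]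
([small_increment]). Call a position fresh when the factor of length [m]
starting there has not occurred earlier. Each factor of length [m] has exactly
one fresh occurrence, so there are [p m] fresh positions. The point is that
they form few intervals: if [i] is not fresh but [i.+1] is, the factor of
length [m.+1] at [i] is new although its prefix of length [m] is old, and this
happens [p m.+1 - p m] times ([count_run_start]). A set with few runs meets
few blocks of length [h] of the integers, about its cardinality divided by [h]
plus its number of runs ([block_count]). With [h = m %/ 12] this is
[O(p a.*2 / a)] blocks, and one cut position just to the right of each block
gives [cut_positions]: every factor of length [m] has an occurrence in [x]
which contains one of [O(p a.*2 / a)] cuts in a prescribed central zone.

Cutting there writes the factor as a word ending at a cut followed by a word
starting at a cut, and the same works for somewhat shorter factors. Given its
length, such a word is determined by its cut and its side. The zone
keeps both words at least proportional to [m], so when [a] runs over the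
powers of two only six scales contribute words of a given length [l]. Hence
[Fac_sub_pow2]: the language of all these pieces has complexity
[O(1 + p (64 * l) / l)], which is [O(l `^ (alpha - 1))]. *)

Set Implicit Arguments.
Unset Strict Implicit.
Unset Printing Implicit Defensive.

Import Order.TTheory GRing.Theory Num.Theory.
Import numFieldNormedType.Exports.

Local Open Scope classical_set_scope.
Local Open Scope ring_scope.

(** * Sets of integers with few runs *)

Section Blocks.
Local Open Scope nat_scope.

Definition run_start (P : pred nat) (i : nat) : bool :=
  P i && ((i == 0) || ~~ P i.-1).

(** Going left from a point of [P], one stays in [P] until a run start is met. *)
Lemma walk_back (P : pred nat) i r : P i ->
  (exists t, [/\ run_start P t, t <= i & i < t + r]) \/
  (r <= i /\ forall k, k <= r -> P (i - k)).
Proof.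
move=> Pi; elim: r => [|r [[t [st ti it]]|[ri Pk]]].
- by right; split=> // k; rewrite leqn0 => /eqP ->; rewrite subn0.
- by left; exists t; split=> //; lia.
have [stop|] := boolP (run_start P (i - r)).
  by left; exists (i - r); split=> //; lia.
rewrite /run_start Pk //= negb_or negbK => /andP[i0 Pi1].
right; split; first lia.
move=> k; rewrite leq_eqVlt ltnS => /orP[/eqP ->|]; last exact: Pk.
by rewrite subnS.
Qed.

(** A run that meets a block either starts in it or contains its left end [j].
In the second case, looking [h] steps back from [j], either a run start is met
(and it determines [j] as the next multiple of [h]) or the whole of
[j - h + 1 .. j] lies in [P], and these intervals are disjoint. *)
Lemma block_count (P : pred nat) N h : 0 < h ->
  h * size (undup [seq i %/ h | i <- iota 0 N & P i])
    <= 2 * h * count (run_start P) (iota 0 N) + count P (iota 0 N).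
Proof.
move=> h0; set I := iota 0 N.
set s := [seq i <- I | run_start P i].
set z := [seq i <- I | P i && (h %| i)].
set z' := [seq i <- I | [&& P i, h %| i, h <= i & all (fun k => P (i - k)) (iota 0 h)]].
have inI i : (i \in I) = (i < N) by rewrite mem_iota.
have Qle : size (undup [seq i %/ h | i <- I & P i]) <= size s + size z.
  rewrite -(size_map (divn^~ h) s) -(size_map (divn^~ h) z) -size_cat.
  apply: uniq_leq_size; first exact: undup_uniq.
  move=> q; rewrite mem_undup => /mapP[i]; rewrite mem_filter inI => /andP[Pi iN] ->.
  rewrite mem_cat; apply/orP.
  have [[t [st ti it]]|[_ /(_ _ (leqnn _)) Pb]] := walk_back (i %% h) Pi.
    left; apply/mapP; exists t; first by rewrite mem_filter st inI; lia.
    have := divn_eq i h; have := ltn_pmod i h0 => ih ie.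
    apply/eqP; rewrite eqn_leq leq_divRL // (leq_div2r _ ti) ?andbT; lia.
  right; apply/mapP; exists (i - i %% h).
    have e : i - i %% h = i %/ h * h by rewrite {1}(divn_eq i h) addnK.
    rewrite mem_filter inI Pb e dvdn_mull //=; rewrite -e; lia.
  by rewrite {2}(divn_eq i h) addnK mulnK.
have zle : size z <= size s + size z'.
  (* A run start t is charged by the least multiple of h that is at least t. *)
  rewrite -(size_map (fun t => (t + h.-1) %/ h * h) s) -size_cat.
  apply: uniq_leq_size; first by rewrite filter_uniq ?iota_uniq.
  move=> j; rewrite mem_filter inI => /andP[/andP[Pj hj] jN].
  rewrite mem_cat; apply/orP.
  have [[t [st tj jt]]|[hj' Pk]] := walk_back h Pj.
    left; apply/mapP; exists t; first by rewrite mem_filter st inI; lia.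
    case/dvdnP: hj jt tj {Pj jN} => a -> jt tj.
    congr (_ * h); apply/eqP; rewrite eqn_leq leq_divRL // -[_ %/ h <= a]ltnS ltn_divLR // mulSn.
    by apply/andP; split; lia.
  right; rewrite mem_filter inI Pj hj hj' jN !andbT /=.
  by apply/allP => k; rewrite mem_iota => /= kh; apply: Pk; lia.
have z'le : h * size z' <= count P I.
  rewrite mulnC -[X in _ * X](size_iota 0) -(size_allpairs (fun j k => j - k)).
  rewrite -size_filter; apply: uniq_leq_size.
    apply: allpairs_uniq; rewrite ?filter_uniq ?iota_uniq //.
    move=> [j k] [j' k'] /allpairsP[[u v] /= [+ + [-> ->]]].
    rewrite mem_filter mem_iota => /andP[/and4P[_ /dvdnP[a ->] au _] _] vh.
    move=> /allpairsP[[u' v'] /= [+ + [-> ->]]].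
    rewrite mem_filter mem_iota => /andP[/and4P[_ /dvdnP[b ->] bu _] _] vh' e.
    move: vh vh' au bu e; rewrite !mem_iota /= !add0n => vh vh' au bu e.
    have [ab|ab|ab] := ltngtP a b; last by subst b; congr pair; lia.
      by have := leq_mul ab (leqnn h); rewrite mulSn; lia.
    by have := leq_mul ab (leqnn h); rewrite mulSn; lia.
  move=> w /allpairsP[[j k] /= [+ + ->]].
  rewrite !mem_filter !inI mem_iota => /andP[/and4P[_ _ _ /allP al] jN] kh.
  by rewrite al ?mem_iota //=; lia.
have -> : count (run_start P) I = size s by rewrite size_filter.
by nia.
Qed.

(** The [a] increments between [a] and [a.*2] telescope to at most [f a.*2]. *)
Lemma small_increment (f : nat -> nat) a : 0 < a ->
  {homo f : m n / m <= n} ->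
  exists2 m, a <= m < a.*2 & a * (f m.+1 - f m) <= f a.*2.
Proof.
move=> a0 fmono; apply: contrapT => none.
have big m : a <= m < a.*2 -> f a.*2 < a * (f m.+1 - f m).
  by move=> am; rewrite ltnNge; apply/negP => le; apply: none; exists m.
have : \sum_(a <= m < a.*2) (f a.*2).+1 <= \sum_(a <= m < a.*2) a * (f m.+1 - f m).
  by rewrite !big_nat; apply: leq_sum => m; exact: big.
rewrite sum_nat_const_nat -big_distrr /= telescope_sumn // -addnn addnK leq_pmul2l //.
by rewrite ltnNge leq_subr.
Qed.

End Blocks.

(** * Fresh occurrences of factors *)

Section Words.
Local Open Scope nat_scope.
Variables (T : choiceType) (A : {fset T}).
Implicit Type (L : set (seq T)).

Lemma complexity_le_size L n (s : seq (seq T)) :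
  (forall w, L w -> size w = n -> w \in s) -> complexity L n <= size s.
Proof.
move=> Ls; rewrite /complexity; apply: uniq_leq_size; first exact: fset_uniq.
have fin : finite_set [set w | L w /\ size w = n].
  by apply: (sub_finite_set _ (finite_seq s)) => w [Lw sw]; exact: Ls.
by move=> w; rewrite in_fset_set // inE => -[Lw sw]; exact: Ls.
Qed.

Lemma finite_language_slice L n :
  language_over A L -> finite_set [set w | L w /\ size w = n].
Proof.
move=> LA; pose words := iter n (fun ws => [seq a :: w | a <- A, w <- ws]) [:: [::]].
apply: (sub_finite_set _ (finite_seq words)) => w [/LA wA sw] /=.
rewrite /words -sw; elim: w wA {sw} => [|a w IHw] wA //=.
by apply/allpairsP; exists (a, w); split;
  [apply: wA; rewrite mem_head | apply: IHw => b bw; apply: wA; rewrite in_cons bw orbT|].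
Qed.

Lemma size_le_complexity L n (s : seq (seq T)) : language_over A L ->
  uniq s -> (forall w, w \in s -> L w /\ size w = n) -> size s <= complexity L n.
Proof.
move=> LA us sL; apply: uniq_leq_size us _ => w ws.
by rewrite in_fset_set ?inE; [exact: sL | exact: finite_language_slice].
Qed.

Variables (x : nat -> T) (hx : forall i, x i \in A).

Definition factor_at i n : seq T := [seq x j | j <- iota i n].

Lemma size_factor_at i n : size (factor_at i n) = n.
Proof. by rewrite size_map size_iota. Qed.

Lemma factor_at_cat i m n :
  factor_at i (m + n) = factor_at i m ++ factor_at (i + m) n.
Proof. by rewrite /factor_at iotaD map_cat. Qed.

Lemma factor_at_split i j m n : factor_at i (m + n) = factor_at j (m + n) ->
  factor_at i m = factor_at j m /\ factor_at (i + m) n = factor_at (j + m) n.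
Proof.
rewrite !factor_at_cat => /eqP.
by rewrite eqseq_cat ?size_factor_at // => /andP[/eqP -> /eqP ->].
Qed.

Lemma Fac_factor_at i n : Fac x (factor_at i n).
Proof. by exists i, n. Qed.

Lemma Fac_over : language_over A (Fac x).
Proof. by move=> w [i [n ->]] a /mapP[j _ ->]; exact: hx. Qed.

Definition fresh n i := factor_at i n \notin [seq factor_at j n | j <- iota 0 i].

Lemma fresh_inj n i j : fresh n i -> fresh n j ->
  factor_at i n = factor_at j n -> i = j.
Proof.
wlog ij : i j / i <= j => [sym fi fj e|fi fj e].
  by case/orP: (leq_total i j) => ij; [|symmetry]; apply: sym.
apply/eqP; rewrite eqn_leq ij leqNgt; apply: contra fj => lt_ij.
by apply/mapP; exists i; rewrite ?mem_iota.
Qed.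

Lemma fresh_occurrence n i : exists2 j, fresh n j & factor_at j n = factor_at i n.
Proof.
have ex : exists j, factor_at j n == factor_at i n by exists i.
case: (ex_minnP ex) => j /eqP e jmin; exists j => //.
apply/mapP => -[k]; rewrite mem_iota /= add0n => kj ek.
by have := jmin k; rewrite -ek e eqxx leqNgt kj => /(_ isT).
Qed.

(** A new prefix makes a longer word new. *)
Lemma freshS n i : fresh n i -> fresh n.+1 i.
Proof.
apply: contra => /mapP[j ji]; rewrite -addn1 => /factor_at_split[e _].
by apply/mapP; exists j.
Qed.

Lemma fresh_le m n i : m <= n -> fresh m i -> fresh n i.
Proof.
by move=> mn; rewrite -(subnK mn); elim: (n - m) => // k IHk /IHk; exact: freshS.
Qed.

Lemma count_fresh_le n N : count (fresh n) (iota 0 N) <= complexity (Fac x) n.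
Proof.
rewrite -size_filter -(size_map (factor_at^~ n)).
apply: size_le_complexity Fac_over _ _.
  rewrite map_inj_in_uniq ?filter_uniq ?iota_uniq // => i j.
  by rewrite !mem_filter => /andP[fi _] /andP[fj _]; exact: fresh_inj.
by move=> w /mapP[i _ ->]; split; [exact: Fac_factor_at | exact: size_factor_at].
Qed.

Lemma fresh_bounded n : exists N, forall i, fresh n i -> i < N.
Proof.
have bound (s : seq (seq T)) :
    exists N, forall i, fresh n i -> factor_at i n \in s -> i < N.
  elim: s => [|w s [N NP]]; first by exists 0.
  have [[i0 [f0 e0]]|none] := pselect (exists i, fresh n i /\ factor_at i n = w).
    exists (maxn N i0.+1) => i fi; rewrite in_cons leq_max.
    case/orP=> [/eqP ew|/(NP i fi) ->//].
    by rewrite (fresh_inj fi f0) ?leqnn ?orbT // ew.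
  exists N => i fi; rewrite in_cons => /orP[/eqP ew|]; last exact: NP.
  by case: none; exists i.
have [N NP] := bound (fset_set [set w | Fac x w /\ size w = n]).
exists N => i fi; apply: (NP i fi).
rewrite in_fset_set ?inE; last exact: finite_language_slice Fac_over.
by split; [exact: Fac_factor_at | exact: size_factor_at].
Qed.

(** If the factor of length [n.+1] at [i] had occurred before at [j], then the
factor of length [n] at [i.+1] would have occurred at [j.+1]. *)
Lemma run_start_freshS n i :
  run_start (fresh n) i.+1 -> fresh n.+1 i && ~~ fresh n i.
Proof.
move=> /andP[fi1 old]; apply/andP; split; last exact: old.
move: fi1; apply: contra => /mapP[j]; rewrite mem_iota add0n => /andP[_ ji].
rewrite -[n.+1]add1n => /factor_at_split[_]; rewrite !addn1 => e.
by apply/mapP; exists j.+1; rewrite ?mem_iota.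
Qed.

(** The runs of fresh positions after a possible one at [0] are paid for by the
increment of the number of distinct factors, both counts being truncated to
the positions below [N]. *)
Lemma count_run_start n N : count (run_start (fresh n)) (iota 0 N) <=
  (count (fresh n.+1) (iota 0 N) - count (fresh n) (iota 0 N)).+1.
Proof.
case: N => [|N] //.
have fS : {subset fresh n <= fresh n.+1} by move=> i; exact: freshS.
pose new i := fresh n.+1 i && ~~ fresh n i.
have newE : count new (iota 0 N.+1) + count (fresh n) (iota 0 N.+1) =
    count (fresh n.+1) (iota 0 N.+1).
  rewrite -[RHS]size_filter -(count_predC (fresh n) [seq i <- iota 0 N.+1 | fresh n.+1 i]) !count_filter addnC.
  congr (_ + _); apply: eq_count => i /=; last by rewrite /new andbC.
  by rewrite (andb_idr (@fS i)).
rewrite -newE addnK -[X in count _ X <= _]/([:: 0] ++ iota (1 + 0) N) iotaDl.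
rewrite count_cat count_map -[leqRHS]add1n.
apply: leq_add; first exact: (count_size _ [:: 0]).
rewrite -[N.+1]addn1 iotaD count_cat; apply: leq_trans (leq_addr _ _).
by apply: sub_count => i; exact: run_start_freshS.
Qed.

(** * Cutting factors at few positions *)

(** The cut attached to the block [q * h, ..., q * h + h - 1] is placed at
[q * h + 2 * h]: seen from any position of the block it lies between [h] and
[2 * h] steps to the right, where [h] is the twelfth part of the length. *)
Lemma cut_positions a : 12 <= a -> exists mC : nat * seq nat,
  [/\ a <= mC.1 < a.*2, a * size mC.2 <= 2 * a + 25 * complexity (Fac x) a.*2 &
    forall i, exists j c, [/\ factor_at j mC.1 = factor_at i mC.1, c \in mC.2 &
      j + mC.1 %/ 12 <= c <= j + 2 * (mC.1 %/ 12)]].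
Proof.
move=> a12.
(* Fresh positions for lengths up to a.*2 are all below N, so truncating at N
   loses none of them. *)
have [N NP] := fresh_bounded a.*2.
pose f n := count (fresh n) (iota 0 N).
have fmono : {homo f : m n / m <= n}.
  by move=> m n mn; apply: sub_count => i; exact: fresh_le.
have [||m am dm] := @small_increment f a; [lia|exact: fmono|].
pose h := m %/ 12.
have h0 : 0 < h by rewrite divn_gt0; lia.
have ma : a <= 23 * h by have := divn_eq m 12; have := @ltn_pmod m 12 isT; lia.
exists (m, [seq q * h + 2 * h | q <- undup [seq i %/ h | i <- iota 0 N & fresh m i]]).
split=> //=.
  rewrite size_map.
  (* h * s <= 2 h r + f m is multiplied by a, using a r <= a + p(2a) and a <= 23 h. *)
  have := block_count (fresh m) N h0; have := count_run_start m N.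
  rewrite -/(f m) -/(f m.+1) => st bl.
  have p1 : f a.*2 <= complexity (Fac x) a.*2 by exact: count_fresh_le.
  have p2 : f m <= f a.*2 by apply: fmono; lia.
  set s := size _ in bl *; set r := count _ _ in st bl.
  rewrite -(leq_pmul2l h0).
  have e1 : a * (h * s) <= a * (2 * h * r + f m) by rewrite leq_mul2l bl orbT.
  have e2 : a * r <= a + f a.*2.
    by apply: leq_trans (leq_mul (leqnn a) st) _; rewrite mulnS leq_add2l.
  have e3 : h * (a * r) <= h * (a + f a.*2) by rewrite leq_mul2l e2 orbT.
  have e4 : a * f m <= 23 * h * complexity (Fac x) a.*2.
    by apply: leq_mul => //; exact: leq_trans p1.
  have e5 : h * f a.*2 <= h * complexity (Fac x) a.*2 by rewrite leq_mul2l p1 orbT.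
  nia.
move=> i; have [j fj ej] := fresh_occurrence m i.
exists j, (j %/ h * h + 2 * h); split=> //; last first.
  by have := divn_eq j h; have := @ltn_pmod j h h0; rewrite -/h; lia.
apply/mapP; exists (j %/ h) => //; rewrite mem_undup; apply/mapP; exists j => //.
rewrite mem_filter fj mem_iota /=; apply: NP.
by apply: fresh_le fj; lia.
Qed.

(** A factor of a one-sided infinite word extends to the right. *)
Lemma complexity_Fac_le m n : m <= n ->
  complexity (Fac x) m <= complexity (Fac x) n.
Proof.
move=> mn; rewrite [leqRHS]/complexity -(size_map (take m)).
apply: complexity_le_size => w [i [k ->]]; rewrite size_map size_iota => ->.
apply/mapP; exists (factor_at i n).
  rewrite in_fset_set ?inE; last exact: finite_language_slice Fac_over.
  by split; [exact: Fac_factor_at | exact: size_factor_at].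
by rewrite -(subnKC mn) factor_at_cat take_size_cat ?size_factor_at.
Qed.

(** The scales are [2 ^ (k + 4)]. The pieces kept at a scale of length [m] have
length between [m %/ 12] and [m]; this lower bound is what prevents infinitely
many scales from contributing to the same length. *)
Lemma Fac_sub_pow2 : exists S : set (seq T),
  [/\ language_over A S, Fac x `<=` lang_pow S 2 &
    forall l, 16 <= l ->
      l * complexity S l <= 1536 * (l + complexity (Fac x) (64 * l))].
Proof.
have scale k : 12 <= 2 ^ (k + 4) by rewrite expnD; have := expn_gt0 2 k; lia.
have [mC mCP] := choice (fun k => cut_positions (scale k)).
pose S : set (seq T) := [set w | (Fac x w /\ size w <= 8) \/
  exists k c l, [/\ c \in (mC k).2, (mC k).1 %/ 12 <= l <= (mC k).1 &
    w = factor_at c l \/ l <= c /\ w = factor_at (c - l) l]].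
exists S; split.
- move=> w [[Fw _]|[k [c [l [_ _ [->|[_ ->]]]]]]]; apply: Fac_over => //; exact: Fac_factor_at.
- move=> w [i [M ->]]; rewrite -/(factor_at i M).
  have [M8|M8] := leqP M 8.
    (* Below the smallest scale, the second piece is the empty word. *)
    exists [:: factor_at i M; factor_at i 0]; split=> //; last by rewrite /= !cats0.
    move=> u; rewrite !inE => /orP[]/eqP ->; left; rewrite size_factor_at //;
      by split=> //; exact: Fac_factor_at.
  have /andP[lo hi] := @up_log_bounds 2 M isT (ltn_trans (isT : 1 < 8) M8).
  set t := up_log 2 M in lo hi.
  have t4 : 4 <= t.
    by rewrite -(ltn_exp2l 3 t (isT : 1 < 2)); exact: leq_trans hi.
  (* The scale is the least power of two above M; a factor of length m at i
     then extends the one of length M, and m < 4 * M leaves the right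
     piece at least M - 2 * h >= h letters. *)
  have [k tk] : exists k, t = k + 4 by exists (t - 4); lia.
  have [mb _ /(_ i)[j [c [ej cC cb]]]] := mCP k.
  set m := (mC k).1 in mb ej cb; set h := m %/ 12 in cb.
  have hm : 12 * h <= m by have := divn_eq m 12; rewrite -/h; lia.
  have m4 : m < 4 * M.
    have e : 2 ^ (k + 4) = 2 * 2 ^ t.-1 by rewrite -tk -expnS prednK //; lia.
    lia.
  rewrite -tk in mb.
  have Mm : M <= m by lia.
  have eM : factor_at j M = factor_at i M.
    by have := ej; rewrite -(subnKC Mm) => /factor_at_split[].
  have cM : c - j <= M by lia.
  exists [:: factor_at j (c - j); factor_at c (M - (c - j))]; split=> //; last first.
    by rewrite /= cats0 -eM -{1}(subnKC cM) factor_at_cat subnKC //; lia.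
  move=> u; rewrite !inE => /orP[]/eqP ->; right.
    exists k, c, (c - j); split=> //; first by rewrite -/m -/h; lia.
    by right; split; [lia | congr factor_at; lia].
  by exists k, c, (M - (c - j)); split=> //; [rewrite -/m -/h; lia | left].
move=> l l16.
(* For t the binary logarithm of l, a scale contributing to length l satisfies
   t <= k + 4 < t + 6, because 2 ^ (k + 4) <= m <= 23 * (m %/ 12) <= 23 * l. *)
have /andP[lo hi] := @trunc_log_bounds 2 l isT (leq_trans (isT : 0 < 16) l16).
set t := trunc_log 2 l in lo hi.
have t4 : 4 <= t by rewrite -ltnS -(ltn_exp2l 4 t.+1 (isT : 1 < 2)); exact: leq_ltn_trans hi.
pose pieces k := [seq factor_at c l | c <- (mC k).2] ++ [seq factor_at (c - l) l | c <- (mC k).2].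
have Ssub w : S w -> size w = l -> w \in flatten [seq pieces k | k <- iota (t - 4) 6].
  move=> [[_ w8] sw|[k [c [l' [cC lb wE]]]]]; first by move: w8; rewrite sw; lia.
  have -> : size w = l' by case: wE => [->|[_ ->]]; rewrite size_factor_at.
  move=> e; subst l'; apply/flatten_mapP; exists k; last first.
    by rewrite mem_cat; apply/orP; case: wE => [->|[_ ->]]; [left|right]; apply/mapP; exists c.
  have [mb _ _] := mCP k; rewrite mem_iota.
  set m := (mC k).1 in mb lb.
  have t1 : t < k + 5 by rewrite -(ltn_exp2l _ _ (isT : 1 < 2)) addnS expnS; lia.
  have t2 : k + 4 < t + 6.
    rewrite -(ltn_exp2l _ _ (isT : 1 < 2)) [in X in _ < X]expnD.
    by move: hi; rewrite expnS; have := divn_eq m 12; have := @ltn_pmod m 12 isT; lia.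
  lia.
have size_pieces k : k \in iota (t - 4) 6 ->
    l * size (pieces k) <= 256 * (l + complexity (Fac x) (64 * l)).
  rewrite mem_iota => /andP[k1 k2]; have [_ sz _] := mCP k.
  have e1 : 2 ^ t <= 2 ^ (k + 4) by rewrite leq_exp2l //; lia.
  have e2 : 2 ^ (k + 4) <= 32 * l.
    apply: (@leq_trans (32 * 2 ^ t)); last by rewrite leq_mul2l lo orbT.
    by rewrite -[32]/(2 ^ 5) -expnD leq_exp2l //; lia.
  have e3 : complexity (Fac x) (2 ^ (k + 4)).*2 <= complexity (Fac x) (64 * l).
    by apply: complexity_Fac_le; lia.
  rewrite size_cat !size_map.
  set s := size _ in sz *.
  have e4 : 2 ^ t * s <= 2 ^ (k + 4) * s by rewrite leq_mul2r e1 orbT.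
  have e5 : l * s <= 2 * (2 ^ t * s).
    by rewrite mulnA leq_mul2r -expnS (ltnW hi) orbT.
  rewrite mulnDr; lia.
apply: (@leq_trans (l * size (flatten [seq pieces k | k <- iota (t - 4) 6]))).
  by rewrite leq_mul2l complexity_le_size ?orbT //.
rewrite size_flatten /shape -map_comp sumnE big_map big_distrr /=.
pose B := 256 * (l + complexity (Fac x) (64 * l)).
apply: (@leq_trans (\sum_(k <- iota (t - 4) 6) B)).
  by rewrite big_seq [leqRHS]big_seq; apply: leq_sum => k; exact: size_pieces.
by rewrite big_const_seq count_predT size_iota iter_addn addn0 /B; lia.
Qed.
End Words.

(** * Growth rates *)

Section Growth.
Variables (R : realType) (T : choiceType) (L S : set (seq T)) (alpha : R).

(** The term [n] on the right is harmless as [n <= n `^ alpha], and the dilation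
by [k.+1] only costs the constant [k.+1 `^ alpha]. *)
Lemma poly_growth_averaged (b k n0 : nat) : 1 <= alpha ->
  poly_growth L alpha ->
  (forall n, (n0 <= n)%N ->
    (n * complexity S n <= b * (n + complexity L (k.+1 * n)))%N) ->
  poly_growth S (alpha - 1).
Proof.
move=> alpha1 /eqO_exP[C C0 [N _ NC]] SL; apply/eqO_exP.
have K0 : 0 < k.+1%:R `^ alpha :> R by rewrite powR_gt0.
exists (b.+1%:R * (1 + C * k.+1%:R `^ alpha)).
  by rewrite mulr_gt0 // addr_gt0 // mulr_gt0.
exists (maxn n0 N).+1 => // n /=; rewrite gtn_max => /andP[n0n Nn].
have n1 : 1 <= n%:R :> R by rewrite ler1n; lia.
have n0' : 0 < n%:R :> R by exact: lt_le_trans n1.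
have := NC (k.+1 * n)%N; rewrite /= => /(_ _)/wrap[]; first by nia.
rewrite !ger0_norm ?powR_ge0 // natrM powRM // => LC.
rewrite powRB ?(gt_eqF n0') ?implybT // powRr1 ?(ltW n0') //.
rewrite mulrA ler_pdivlMr // mulrC.
have := SL n (ltnW n0n); rewrite -(ler_nat R) natrM natrM natrD => /le_trans; apply.
have e : n%:R <= n%:R `^ alpha :> R by rewrite -[leLHS]powRr1 ?ler_powR // ltW.
rewrite -mulrA; apply: ler_pM; rewrite ?addr_ge0 ?ler_nat //.
by rewrite mulrDl mul1r; apply: lerD => //; rewrite -mulrA.
Qed.

End Growth.

Theorem corollary5p2 (R : realType) (alpha : R) (halpha : 1 <= alpha)
    (T : choiceType) (A : {fset T}) (hA : A != fset0)
    (x : nat -> T) (hx : forall i : nat, x i \in A)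
    (hgrowth : poly_growth (Fac x) alpha) :
  (cost R x <= (Num.min alpha (2 * alpha - 2))%:E)%E.
Proof.
have [S [SA FS Sgrowth]] := Fac_sub_pow2 hx.
apply: (@le_trans _ _ (alpha - 1)%:E); last by rewrite lee_fin le_min; lra.
apply: ereal_inf_lbound; exists (alpha - 1) => //; split; first lra.
apply: (@le_lt_trans _ _ (2%:R)%:E); last exact: ltry.
apply: ereal_inf_lbound; exists 2%N => //; split=> //.
exists S; split=> //; exists A; split=> //.
exact: poly_growth_averaged halpha hgrowth Sgrowth.
Qed.
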